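(* For even $n$, let $\mathrm{EQ}'_n$ be the partial two-party function defined on pairs $(x,y)\in\{0,1\}^n\times\{0,1\}^n$ by $$\mathrm{EQ}'_n(x,y)=\begin{cases}1 & \text{if } H(x,y)\in\{0,1,n-1,n\},\\ 0 & \text{if } H(x,y)=\tfrac{n}{2},\end{cases}$$ and undefined otherwise, where $H(x,y)$ is the Hamming distance. Then the deterministic communication complexity satisfies $D(\mathrm{EQ}'_n)\in \mathbf{\Omega}(n)$.
   Context: Two-party communication model: Alice holds $x$, Bob holds $y$; they alternately exchange bit strings according to a deterministic protocol, local computation being free. A deterministic protocol computes a partial function $f$ if for every input pair in the domain of $f$ it terminates with output $f(x,y)$ (no requirement on inputs outside the domain). The cost of a protocol is the worst-case number of bits exchanged, and $D(f)$ is the minimum cost of a deterministic protocol computing $f$. *)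

(* Defs.v *)
From HB Require Import structures.
From mathcomp Require Import all_boot all_order all_algebra.
From mathcomp Require Import boolp classical_sets reals topology normedtype.
From mathcomp Require Import landau.

Set Implicit Arguments.
Unset Strict Implicit.
Unset Printing Implicit Defensive.

Local Open Scope nat_scope.

(* Partial functions are X -> Y -> option bool, with None outside the domain. *)

(* Protocol trees.  At an internal node the owner sends one bit, depending on
   their own input and on the node, i.e. on the transcript so far; a message
   made of several bits is a run of consecutive nodes with the same owner. *)
Inductive protocol (X Y : Type) : Type :=
| Output of bool
| Alice of (X -> bool) & protocol X Y & protocol X Y
| Bob of (Y -> bool) & protocol X Y & protocol X Y.

Arguments Output {X Y}.

Section Protocols.
Variables X Y : finType.
Implicit Types (p : protocol X Y) (f : X -> Y -> option bool).

Fixpoint output p (x : X) (y : Y) : bool :=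
  match p with
  | Output b => b
  | Alice a p1 p0 => if a x then output p1 x y else output p0 x y
  | Bob b p1 p0 => if b y then output p1 x y else output p0 x y
  end.

Fixpoint bits_exchanged p (x : X) (y : Y) : nat :=
  match p with
  | Output _ => 0
  | Alice a p1 p0 =>
      (if a x then bits_exchanged p1 x y else bits_exchanged p0 x y).+1
  | Bob b p1 p0 =>
      (if b y then bits_exchanged p1 x y else bits_exchanged p0 x y).+1
  end.

Definition cost p : nat := \max_(xy : X * Y) bits_exchanged p xy.1 xy.2.

Definition computes p f : Prop :=
  forall x y b, f x y = Some b -> output p x y = b.

Lemma computes_ex f : exists p, computes p f.
Proof.
pose g x y := odflt false (f x y).
suff [p Hp] : exists p, forall x y, output p x y = g x y.
  by exists p => x y b fxy; rewrite Hp /g fxy.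
have HB x : exists p, forall x' y, output p x' y = g x y.
  suff [p Hp] : exists p, forall x' y, y \in enum Y -> output p x' y = g x y.
    by exists p => x' y; apply: Hp; rewrite mem_enum.
  elim: (enum Y) => [|y0 s [p Hp]]; first by exists (Output false).
  exists (Bob (pred1 y0) (Output (g x y0)) p) => x' y.
  by rewrite inE /=; case: eqP => [->|_ /=] //; exact: Hp.
suff [p Hp] : exists p, forall x y, x \in enum X -> output p x y = g x y.
  by exists p => x y; apply: Hp; rewrite mem_enum.
elim: (enum X) => [|x0 s [p Hp]]; first by exists (Output false).
have [q Hq] := HB x0; exists (Alice (pred1 x0) q p) => x y.
by rewrite inE /=; case: eqP => [->|_ /=] //; exact: Hp.
Qed.

Lemma cost_ex f : exists d, `[< exists p, computes p f /\ cost p = d >].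
Proof.
by have [p Hp] := computes_ex f; exists (cost p); apply/asboolP; exists p.
Qed.

(* D(f), the least cost of a protocol computing f. *)
Definition det_cc f : nat := ex_minn (cost_ex f).

End Protocols.

Definition hamming n (x y : n.-tuple bool) : nat :=
  #|[set i : 'I_n | tnth x i != tnth y i]|.

(* The two clauses are disjoint for every even n except 0 and 2. *)
Definition EQ' n (x y : n.-tuple bool) : option bool :=
  if hamming x y \in [:: 0; 1; n.-1; n] then Some true
  else if hamming x y == n./2 then Some false
  else None.

(* Main.v *)
Require Import Defs.
From mathcomp Require Import all_boot all_order all_algebra.
From mathcomp Require Import ring lra zify.

(* A protocol of cost d leaves, among 3^N inputs on the diagonal, at least
   3^N / 2^d in a common 1-rectangle.  Coding each letter of a ternary word by
   one of 000, 011, 101 doubles Hamming distances, so the rectangle yields a set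
   A of ternary words of length N avoiding the distance m, where n = 4m or
   n = 4m + 2 (in the second case one further position differs, which is why
   inputs at distance 1 matter) and N is slightly larger than m.  It remains to
   bound A by an exponentially small fraction of all words, in the manner of
   Frankl and Rodl.  Consider pairs (A, B) avoiding an interval of distances.
   Fixing the first letter either increases the product of the densities by a
   constant factor 1 + eta, or widens the interval by one at the cost of a
   factor 1 - O(eta); as densities are at most 1, if A were large the interval
   would reach length 2k = Omega(N) while the density product stayed above
   (1 + eta)^(-O(k)), and this contradicts the expansion of Hamming balls. *)

Set Implicit Arguments.
Unset Strict Implicit.
Unset Printing Implicit Defensive.
Import Order.TTheory GRing.Theory Num.Theory.

Local Open Scope ring_scope.

(** * Ternary words *)

Fixpoint word (N : nat) : finType :=
  if N is N'.+1 then ('I_3 * word N')%type else unit.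

Fixpoint wdist N : word N -> word N -> nat :=
  match N return word N -> word N -> nat with
  | 0 => fun _ _ => 0%N
  | N'.+1 => fun x y => ((x.1 != y.1) + wdist x.2 y.2)%N
  end.

Lemma wdistxx N (x : word N) : wdist x x = 0%N.
Proof. by elim: N x => //= N IH [i x] /=; rewrite eqxx IH. Qed.

Lemma wdistC N (x y : word N) : wdist x y = wdist y x.
Proof. by elim: N x y => //= N IH [i x] [j y] /=; rewrite eq_sym IH. Qed.

Lemma wdist_triangle N (x y z : word N) :
  (wdist x z <= wdist x y + wdist y z)%N.
Proof.
elim: N x y z => //= N IH [i x] [j y] [k z] /=.
rewrite addnACA leq_add //.
by case: (eqVneq i k) => // ik; case: (eqVneq i j) => // <-; rewrite ik.
Qed.

(** Advancing the first [d] letters cyclically is an injection, so it keeps densities, and it moves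
    every word by exactly [d]. *)
Fixpoint rotw N (d : nat) : word N -> word N :=
  match N return word N -> word N with
  | 0 => id
  | N'.+1 => fun x => if d is d'.+1 then (ordS x.1, rotw d' x.2) else x
  end.

Lemma rotw_inj N d : injective (@rotw N d).
Proof.
elim: N d => [|N IH] [|d] //= [i x] [j y] /= [ij xy].
by congr (_, _); [apply: ordS_inj; apply: val_inj | exact: IH xy].
Qed.

Lemma wdist_rotw N d (x : word N) : (d <= N)%N -> wdist (rotw d x) x = d.
Proof.
elim: N d x => [|N IH] [|d] //= [i x] dN /=; first by rewrite eqxx wdistxx.
by rewrite IH //; case: i => [[|[|[|i]]]].
Qed.

(** * Densities of sets of words *)

Section Density.
Variable R : realFieldType.

Definition density N (A : {set word N}) : R := #|A|%:R / 3 ^+ N.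

Definition fiber N (A : {set word N.+1}) (i : 'I_3) : {set word N} :=
  [set x | (i, x) \in A].

Lemma density_ge0 N (A : {set word N}) : 0 <= density A.
Proof. by rewrite divr_ge0 ?exprn_ge0. Qed.

Lemma card_word N : #|word N| = (3 ^ N)%N.
Proof.
by elim: N => [|N IH] /=; rewrite ?card_unit // card_prod card_ord IH expnS.
Qed.

Lemma density_le1 N (A : {set word N}) : density A <= 1.
Proof.
rewrite ler_pdivrMr ?exprn_gt0 // mul1r -natrX ler_nat -card_word.
exact: max_card.
Qed.

Lemma density_imset N (f : word N -> word N) (A : {set word N}) :
  injective f -> density (f @: A) = density A.
Proof. by move=> f_inj; rewrite /density card_imset. Qed.

Lemma densityUI N (A B : {set word N}) :
  density (A :|: B) + density (A :&: B) = density A + density B.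
Proof. by rewrite -!mulrDl -!natrD cardsUI. Qed.

Lemma card_fiber N (A : {set word N.+1}) : #|A| = (\sum_i #|fiber A i|)%N.
Proof.
transitivity (\sum_i \sum_(x | (i, x) \in A) 1)%N.
  by rewrite pair_big_dep -sum1_card; apply: eq_bigl => -[i x].
by apply: eq_bigr => i _; rewrite -sum1_card; apply: eq_bigl => x; rewrite inE.
Qed.

Lemma density_fiber N (A : {set word N.+1}) :
  \sum_i density (fiber A i) = 3 * density A.
Proof.
rewrite -mulr_suml -natr_sum -card_fiber /density exprS invfM.
by rewrite [RHS]mulrCA mulVKf ?pnatr_eq0.
Qed.

Lemma exists_max3 (f : 'I_3 -> R) : exists i, forall j, f j <= f i.
Proof.
exists [arg max_(i > ord0) f i]%O.
by case: Order.TotalTheory.arg_maxP => // i _ Hi j; exact: Hi.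
Qed.

Lemma sum3 (f : 'I_3 -> R) :
  \sum_i f i = f ord0 + f (inord 1) + f (inord 2).
Proof.
rewrite !big_ord_recl big_ord0 addr0 addrA.
by congr (_ + f _ + f _); apply: val_inj; rewrite /= inordK.
Qed.

(** * Expansion of Hamming balls *)

Lemma expansion_step (K c F X a b : R) (f g : 'I_3 -> R) :
  1 <= K -> (1 + K) ^+ 2 <= 4 * K * c -> 0 <= F -> 0 <= X ->
  (forall i, 0 <= f i) -> (forall i, 0 <= g i) ->
  \sum_i f i = 3 * a -> \sum_i g i = 3 * b ->
  (forall i, f i * g i * (K * X) <= F) ->
  (forall i j, f i * g j * X <= F) ->
  a * b * (K * X) <= c * F.
Proof.
move=> K1 Kc F0 X0 f0 g0 fa gb diag off.
have [i0 Hmax] := exists_max3 f.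
set al := f i0 in Hmax.
have a0 : 0 <= a.
  by move: fa; rewrite sum3; move: (f0 ord0) (f0 (inord 1)) (f0 (inord 2)); lra.
have aal : a <= al.
  move: fa (Hmax ord0) (Hmax (inord 1)) (Hmax (inord 2)).
  by rewrite sum3; lra.
have c0 : 0 <= c by nra.
have [al0|al0] := leP al 0.
  have -> : a = 0 by apply/eqP; rewrite eq_le a0 (le_trans aal).
  by rewrite !mul0r mulr_ge0.
(* The right side is [F] times the chord of the convex function t |-> [al ^+ 2 / t] between [al / K]
   and [al]: [diag] serves on that interval, [off] to its left. Being linear in [f i], it can be
   summed over the letters. *)
have key i : al ^+ 2 * (g i * (K * X)) <= F * (al * (1 + K) - K * f i).
  have [h|h] := leP (K * f i) al.
    have : al * K * (al * g i * X) <= al * K * F.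
      by rewrite ler_wpM2l ?off // mulr_ge0; lra.
    have : 0 <= F * (al - K * f i) by rewrite mulr_ge0 // subr_ge0.
    nra.
  have fi0 : 0 < f i by nra.
  rewrite -(ler_pM2l fi0).
  have h1 : al ^+ 2 * (f i * g i * (K * X)) <= al ^+ 2 * F.
    by rewrite ler_wpM2l ?diag ?sqr_ge0.
  have h2 : 0 <= F * ((al - f i) * (K * f i - al)).
    by rewrite mulr_ge0 // mulr_ge0 // subr_ge0 // ltW.
  nra.
have sum_key : al ^+ 2 * (b * (K * X)) <= F * (al * (1 + K) - K * a).
  move: (key ord0) (key (inord 1)) (key (inord 2)) fa gb; rewrite !sum3.
  move: (f ord0) (f (inord 1)) (f (inord 2)).
  move: (g ord0) (g (inord 1)) (g (inord 2)).
  move=> g1 g2 g3 f1 f2 f3 k1 k2 k3 fa gb.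
  have -> : a = (f1 + f2 + f3) / 3 by rewrite fa; lra.
  have -> : b = (g1 + g2 + g3) / 3 by rewrite gb; lra.
  lra.
have K0 : 0 < K by lra.
have al20 : 0 < al ^+ 2 by rewrite exprn_gt0.
rewrite -(ler_pM2l (mulr_gt0 K0 al20)).
have h1 : (K * a) * (al ^+ 2 * (b * (K * X))) <=
          (K * a) * (F * (al * (1 + K) - K * a)).
  by rewrite ler_wpM2l // mulr_ge0 // ltW.
(* AM-GM: the factors [K * a] and [al * (1 + K) - K * a] have the fixed sum [al * (1 + K)]. *)
have h2 : F * ((K * a) * (al * (1 + K) - K * a)) <= F * (al ^+ 2 * (K * c)).
  rewrite ler_wpM2l //.
  have : 0 <= (2 * (K * a) - al * (1 + K)) ^+ 2 by rewrite sqr_ge0.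
  have : al ^+ 2 * (1 + K) ^+ 2 <= al ^+ 2 * (4 * K * c).
    by rewrite ler_wpM2l // ltW.
  nra.
lra.
Qed.

Lemma expansion_const_ge1 (K c : R) :
  1 <= K -> (1 + K) ^+ 2 <= 4 * K * c -> 1 <= c.
Proof.
move=> K1 Kc; have h : 0 <= (K - 1) ^+ 2 by rewrite sqr_ge0.
by rewrite -(ler_pM2l (_ : 0 < 4 * K)); [nra | lra].
Qed.

(* Sets far apart have small densities: the constant [c] is at its best the
   maximum of [s (1 + K - K s)], where [s] is the ratio of the average to the
   largest fiber density of [A]. *)
Lemma expansion (K c : R) N (A B : {set word N}) (r : nat) :
  1 <= K -> (1 + K) ^+ 2 <= 4 * K * c ->
  (forall x y, x \in A -> y \in B -> (r <= wdist x y)%N) ->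
  density A * density B * K ^+ r <= c ^+ N.
Proof.
move=> K1 Kc.
have c1 := expansion_const_ge1 K1 Kc.
elim: N A B r => [|N IH] A B [|r] far.
- rewrite !expr0 mulr1 mulr_ile1 ?density_ge0 ?density_le1 //.
- have [->|[x xA]] := set_0Vmem A.
    by rewrite /density cards0 !mul0r expr0 ler01.
  have [->|[y yB]] := set_0Vmem B.
    by rewrite /density cards0 !(mul0r, mulr0) expr0 ler01.
  by have := far x y xA yB.
- rewrite expr0 mulr1; apply: le_trans (exprn_ege1 _ c1).
  by rewrite mulr_ile1 ?density_ge0 ?density_le1.
rewrite [K ^+ _]exprS [c ^+ _]exprS.
apply: (@expansion_step _ _ _ _ _ _ (fun i => density (fiber A i))
                                     (fun i => density (fiber B i))) => //.
- by rewrite exprn_ge0 // (le_trans ler01).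
- by rewrite exprn_ge0 // (le_trans ler01).
- by move=> i; exact: density_ge0.
- by move=> i; exact: density_ge0.
- exact: density_fiber.
- exact: density_fiber.
- move=> i; rewrite -exprS; apply: IH => x y; rewrite !inE => xA yB.
  by have /= := far _ _ xA yB; rewrite eqxx.
- move=> i j; apply: IH => x y; rewrite !inE => xA yB.
  have /= := far _ _ xA yB.
  by case: (i != j); rewrite /= ?add0n ?add1n // => /ltnW.
Qed.

(** * Avoiding an interval of distances *)

Definition avoids N (A B : {set word N}) (lo hi : nat) : Prop :=
  forall x y, x \in A -> y \in B -> ~~ (lo <= wdist x y <= hi)%N.

(* Moving [B] by a fixed distance [l + k] turns an avoided interval centred at
   [l + k] into separation by more than [k]. *)
Lemma avoids_interval_density (K c : R) N (A B : {set word N}) (l k : nat) :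
  1 <= K -> (1 + K) ^+ 2 <= 4 * K * c -> (l + k <= N)%N ->
  avoids A B l (l + k.*2) ->
  density A * density B * K ^+ k <= c ^+ N.
Proof.
move=> K1 Kc lkN AB.
rewrite -(density_imset B (@rotw_inj N (l + k))).
apply: expansion => // x _ xA /imsetP[y yB ->].
have := AB _ _ xA yB.
have := wdist_rotw y lkN; have := wdist_triangle x (rotw (l + k) y) y.
have := wdist_triangle (rotw (l + k) y) x y; rewrite (wdistC (rotw _ _) x).
rewrite -addnn; lia.
Qed.

Lemma bernoulli_ge (x : R) n : 0 <= x -> 1 + n%:R * x <= (1 + x) ^+ n.
Proof.
move=> x0; elim: n => [|n IH]; first by rewrite mul0r addr0 expr0.
rewrite exprS -natr1.
apply: le_trans (ler_wpM2l _ IH); last by rewrite addr_ge0.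
have : 0 <= n%:R * x * x by rewrite !mulr_ge0.
by move: (n%:R) => y; lra.
Qed.

(** The upper bound 1 / (1 - n x) for the power, with the denominator cleared. *)
Lemma bernoulli_le (x : R) n :
  0 <= x -> n%:R * x <= 1 -> (1 + x) ^+ n * (1 - n%:R * x) <= 1.
Proof.
move=> x0; elim: n => [|n IH] nx; first by rewrite mul0r subr0 expr0 mulr1.
have nx' : n%:R * x <= 1 by apply: le_trans nx; rewrite ler_wpM2r // ler_nat.
apply: le_trans (IH nx'); rewrite exprSr -mulrA ler_wpM2l //.
  by rewrite exprn_ge0 // addr_ge0.
have : 0 <= n%:R * x * x by rewrite !mulr_ge0.
have : 0 <= x * x by rewrite mulr_ge0.
by rewrite -natr1; move: (n%:R) => y; lra.
Qed.

(** * Density increment or wider interval *)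

Lemma avoids_same_letter N (A B : {set word N.+1}) i lo hi :
  avoids A B lo hi -> avoids (fiber A i) (fiber B i) lo hi.
Proof.
by move=> AB x y; rewrite !inE => xA yB; have /= := AB _ _ xA yB; rewrite eqxx.
Qed.

Lemma avoids_diff_letter N (A B : {set word N.+1}) i j lo hi :
  i != j -> avoids A B lo.+1 hi.+1 -> avoids (fiber A i) (fiber B j) lo hi.
Proof.
by move=> ij AB x y; rewrite !inE => xA yB; have /= := AB _ _ xA yB; rewrite ij.
Qed.

(** The interval may drift down by one per consumed letter; only its length has to be preserved. *)
Lemma avoids_fiber N (A B : {set word N.+1}) i j l w :
  avoids A B l.+1 (l.+1 + w) ->
  exists2 l', (l <= l' <= l.+1)%N & avoids (fiber A i) (fiber B j) l' (l' + w).
Proof.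
have [-> AB|ij AB] := eqVneq i j.
  by exists l.+1; rewrite ?leqnn ?leqnSn //; exact: avoids_same_letter.
by exists l; rewrite ?leqnn ?leqnSn //; exact: avoids_diff_letter.
Qed.

(** Prefixing y with [i] excludes the distances l + 1 to l + 1 + w, prefixing it with [j] those from
    l to l + w; a y in both fibers excludes the union. *)
Lemma avoids_widen N (A B : {set word N.+1}) i j l w :
  i != j -> avoids A B l.+1 (l.+1 + w) ->
  avoids (fiber A i) (fiber B i :&: fiber B j) l (l + w.+1).
Proof.
move=> ij AB x y xA; rewrite inE => /andP[yBi yBj].
have := avoids_same_letter AB xA yBi.
have := @avoids_diff_letter _ _ _ _ _ l (l + w) ij AB _ _ xA yBj.
move: (wdist x y) => d; clear; lia.
Qed.

(** To first order the two factors lose 10 [eta]; the eleventh power leaves a surplus [eta], which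
    covers the term 110 [eta]^2. *)
Lemma widen_factor (eta : R) :
  0 <= eta -> eta <= 1 / 110 ->
  1 <= (1 + eta) ^+ 11 * ((1 - 2 * eta) * (1 - 8 * eta)).
Proof.
move=> eta0 eta1.
have pos : 0 <= (1 - 2 * eta) * (1 - 8 * eta) by rewrite mulr_ge0; lra.
apply: le_trans (ler_wpM2r pos (bernoulli_ge 11 eta0)).
have : 0 <= eta * (1 - 110 * eta) by rewrite mulr_ge0; lra.
have : 0 <= eta * eta * eta by rewrite !mulr_ge0.
have : 0 <= eta * eta by rewrite mulr_ge0.
lra.
Qed.

(* If no fiber is much denser than its set, then the fibers of [B] at two
   letters either nearly coincide, so that their intersection makes two
   distances forbidden at once, or have a union noticeably denser than [B]. *)
Lemma density_increment_or_widen (eta : R) N (A B : {set word N.+1}) l w :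
  0 <= eta <= 1 / 110 -> avoids A B l.+1 (l.+1 + w) ->
  (exists A' B' : {set word N}, exists l',
     [/\ (l <= l' <= l.+1)%N, avoids A' B' l' (l' + w) &
         (1 + eta) * (density A * density B) <= density A' * density B']) \/
  (exists A' B' : {set word N},
     avoids A' B' l (l + w.+1) /\
     density A * density B <= (1 + eta) ^+ 11 * (density A' * density B')).
Proof.
move=> /andP[eta0 eta1] AB.
have nonneg2 x : 0 <= x -> 0 <= (1 - 2 * eta) * x.
  by move=> x0; rewrite mulr_ge0; lra.
have nonneg4 x : 0 <= x -> 0 <= (1 + 4 * eta) * x.
  by move=> x0; rewrite mulr_ge0; lra.
have nonneg8 x : 0 <= x -> 0 <= (1 - 8 * eta) * x.
  by move=> x0; rewrite mulr_ge0; lra.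
have [i0 Amax] := exists_max3 (fun i => density (fiber A i)).
have [j0 Bmax] := exists_max3 (fun i => density (fiber B i)).
have a0 := density_ge0 A; have b0 := density_ge0 B.
have := density_fiber A; have := density_fiber B; rewrite !sum3.
have := (Amax ord0, Amax (inord 1), Amax (inord 2)).
have := (Bmax ord0, Bmax (inord 1), Bmax (inord 2)).
set o1 : 'I_3 := inord 1; set o2 : 'I_3 := inord 2.
have o01 : ord0 != o1 by rewrite -val_eqE /= inordK.
have o02 : ord0 != o2 by rewrite -val_eqE /= inordK.
have o12 : o1 != o2 by rewrite -val_eqE /= !inordK.
move=> [[B0 B1] B2] [[A0 A1] A2] sB sA.
have aa : density A <= density (fiber A i0) by lra.
have bb : density B <= density (fiber B j0) by lra.
have [big|small] := leP ((1 + eta) * (density A * density B))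
    (density (fiber A i0) * density (fiber B j0)).
  left; have [l' ll' AB'] := avoids_fiber i0 j0 AB.
  by exists (fiber A i0), (fiber B j0), l'.
have [ab00|ab00] := eqVneq (density A * density B) 0.
  left; have [l' ll' AB'] := avoids_fiber i0 j0 AB.
  exists (fiber A i0), (fiber B j0), l'; split=> //.
  by rewrite ab00 mulr0 mulr_ge0 ?density_ge0.
have [a00 b00] : density A != 0 /\ density B != 0.
  by apply/andP; rewrite -negb_or -mulf_eq0.
have a_gt0 : 0 < density A by rewrite lt_def a00.
have b_gt0 : 0 < density B by rewrite lt_def b00.
(* Each largest fiber is at least as dense as its set, so a product below the threshold bounds both
   factors. *)
have asmall : density (fiber A i0) < (1 + eta) * density A.
  rewrite -(ltr_pM2r b_gt0) -(mulrA (1 + eta)).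
  exact: le_lt_trans (ler_wpM2l (density_ge0 _) bb) small.
have bsmall : density (fiber B j0) < (1 + eta) * density B.
  rewrite -(ltr_pM2l a_gt0) (mulrCA _ (1 + eta)).
  exact: le_lt_trans (ler_wpM2r (density_ge0 _) aa) small.
(* Three fibers average to the density and two of them exceed it by a factor less than 1 + [eta], so
   the third keeps at least 3 - 2 (1 + [eta]) - 2 [eta] + 2 [eta] = 1 - 2 [eta] of it. *)
have alow0 : (1 - 2 * eta) * density A <= density (fiber A ord0) by lra.
have alow1 : (1 - 2 * eta) * density A <= density (fiber A o1) by lra.
have blow1 : (1 - 2 * eta) * density B <= density (fiber B o1) by lra.
have blow2 : (1 - 2 * eta) * density B <= density (fiber B o2) by lra.
have [meet|meet] := leP ((1 - 8 * eta) * density B)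
    (density (fiber B o1 :&: fiber B o2)).
  right; exists (fiber A o1), (fiber B o1 :&: fiber B o2).
  split; first exact: avoids_widen.
  have low := ler_pM (nonneg2 _ a0) (nonneg8 _ b0) alow1 meet.
  have lam0 : 0 <= (1 + eta) ^+ 11 by rewrite exprn_ge0 // addr_ge0.
  apply: le_trans (ler_wpM2l lam0 low).
  have ab0 : 0 <= density A * density B by rewrite mulr_ge0.
  have lam := widen_factor eta0 eta1.
  have := ler_wpM2r ab0 lam.
  rewrite mul1r => /le_trans; apply.
  by rewrite le_eqVlt; apply/orP; left; apply/eqP; ring.
(* The letter [ord0] differs from both [o1] and [o2], so the whole union avoids the same shifted
   interval. Its relative density is at least 2 (1 - 2 [eta]) - (1 - 8 [eta]) = 1 + 4 [eta]. *)
left; exists (fiber A ord0), (fiber B o1 :|: fiber B o2), l; split.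
- by rewrite leqnn leqnSn.
- by move=> x y xA; rewrite inE => /orP[]; apply: avoids_diff_letter AB _ _ xA.
have join : (1 + 4 * eta) * density B <= density (fiber B o1 :|: fiber B o2).
  by have := densityUI (fiber B o1) (fiber B o2); lra.
have := ler_pM (nonneg2 _ a0) (nonneg4 _ b0) alow0 join; apply: le_trans.
have ab0 : 0 <= density A * density B by rewrite mulr_ge0.
have lam : 1 + eta <= (1 - 2 * eta) * (1 + 4 * eta) by nra.
have := ler_wpM2r ab0 lam => /le_trans; apply.
by rewrite le_eqVlt; apply/orP; left; apply/eqP; ring.
Qed.

(* [t] bounds the number of letters that may still be consumed, and [g] is the
   amount by which the forbidden interval must still grow to have length 2k.
   Losing a factor (1 + eta)^11 per widening is repaid by the exponent 12 g. *)
Lemma avoids_density_bound (K c eta : R) k Nmax tmax :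
  1 <= K -> (1 + K) ^+ 2 <= 4 * K * c -> 0 <= eta <= 1 / 110 ->
  c ^+ Nmax * (1 + eta) ^+ tmax <= K ^+ k ->
  forall t N (A B : {set word N}) l w g,
  (t <= tmax)%N -> (N <= Nmax)%N -> (w + g = k.*2)%N ->
  (t <= l)%N -> (l + k.*2 + t <= N)%N -> avoids A B l (l + w) ->
  density A * density B * (1 + eta) ^+ t <= (1 + eta) ^+ (12 * g).
Proof.
move=> K1 Kc eta_bnd cK.
have [eta0 _] := andP eta_bnd.
have lam1 : 1 <= 1 + eta by rewrite lerDl.
have lam0 : 0 <= 1 + eta by rewrite addr_ge0.
have c1 := expansion_const_ge1 K1 Kc.
have ab1 N (A B : {set word N}) : 0 <= density A * density B <= 1.
  by apply/andP; split; [apply: mulr_ge0|apply: mulr_ile1];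
     rewrite ?density_ge0 ?density_le1.
elim=> [|t IH] N A B l w g tmx Nmx wg tl lN AB.
  by have /andP[_ h] := ab1 _ A B; rewrite expr0 mulr1 (le_trans h) ?exprn_ege1.
case: g wg => [|g] wg.
  rewrite addn0 in wg; rewrite {}wg in AB.
  have lkN : (l + k <= N)%N.
    by rewrite (leq_trans _ lN) // -addnA leq_add2l -addnn -addnA leq_addr.
  (* The interval is complete: expansion applies, and [cK] absorbs the remaining power of 1 +
     [eta]. *)
  have h := avoids_interval_density K1 Kc lkN AB.
  have Kk : 0 < K ^+ k by rewrite exprn_gt0 // (lt_le_trans ltr01).
  rewrite muln0 expr0 -(ler_pM2r Kk) mul1r; apply: le_trans cK.
  have lt0 : 0 <= (1 + eta) ^+ t.+1 by rewrite exprn_ge0.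
  rewrite mulrAC; apply: le_trans (ler_wpM2r lt0 h) _.
  by apply: ler_pM; rewrite ?exprn_ge0 ?(le_trans ler01 c1) // ler_weXn2l.
case: N A B Nmx lN AB => [|N] A B Nmx lN AB; first by rewrite addnS in lN.
case: l tl lN AB => [|l] // tl lN AB.
have {}tl : (t <= l)%N by [].
have {}lN : (l.+1 + k.*2 + t <= N)%N by rewrite addnS in lN.
have [[A' [B' [l' [ll' AB' inc]]]]|[A' [B' [AB' inc]]]] :=
  density_increment_or_widen eta_bnd AB.
  have := IH N A' B' l' w g.+1; rewrite wg.
  have [ll1 ll2] := andP ll'.
  have l'N : (l' + k.*2 + t <= N)%N by rewrite (leq_trans _ lN) // !leq_add2r.
  move=> /(_ (ltnW tmx) (ltnW Nmx) erefl (leq_trans tl ll1) l'N AB').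
  apply: le_trans.
  rewrite exprS mulrA ler_wpM2r ?exprn_ge0 //.
  by rewrite mulrC.
have := IH N A' B' l w.+1 g; rewrite addSnnS wg.
move=> /(_ (ltnW tmx) (ltnW Nmx) erefl tl (ltnW lN) AB') h.
have l12 : 0 <= (1 + eta) ^+ 12 by rewrite exprn_ge0.
(* Of the 12 factors released by one widening, 11 repay its loss and one accounts for the consumed
   letter. *)
rewrite mulnS exprD; apply: le_trans (ler_wpM2l l12 h).
have lt0 : 0 <= (1 + eta) ^+ t.+1 by rewrite exprn_ge0.
apply: le_trans (ler_wpM2r lt0 inc) _.
rewrite (exprS _ t) (exprS _ 11) le_eqVlt; apply/orP; left; apply/eqP.
move: (density A' * density B') ((1 + eta) ^+ 11) ((1 + eta) ^+ t) => *.
by ring.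
Qed.

Lemma avoids_distance_density (k m : nat) (A : {set word (m + 28 * k)}) :
  (26 * k <= m)%N -> (m <= 172 * k)%N -> avoids A A m m ->
  density A * (1 + (1 / 100) ^+ 2) ^+ k <= 1.
Proof.
set th : R := 1 / 100; set eta := th ^+ 2 => km mk AA.
have eta0 : 0 <= eta by rewrite sqr_ge0.
have etaE : eta = 1 / 100 * (1 / 100) by rewrite /eta expr2.
pose c := 1 + eta / 4.
have c0 : 0 <= c by rewrite /c; lra.
(* For each unit of k the left side costs about 200 [eta] / 4 + 26 [eta] = 76 [eta] = 0.0076 in the
   exponent, less than [th] = 0.01. *)
have Kc : c ^+ (200 * k) * (1 + eta) ^+ (26 * k) <= (1 + th) ^+ k.
  have th0 : 0 <= 1 + th by rewrite /th; lra.
  have lam0 : 0 <= 1 + eta by rewrite addr_ge0.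
  rewrite !exprM -exprMn lerXn2r ?nnegrE ?mulr_ge0 ?exprn_ge0 //.
  have h1 : c ^+ 200 * (1 - 200 * (eta / 4)) <= 1.
    by apply: bernoulli_le; rewrite etaE; lra.
  have h2 : (1 + eta) ^+ 26 * (1 - 26 * eta) <= 1.
    by apply: bernoulli_le; rewrite etaE; lra.
  have p1 : 0 < 1 - 200 * (eta / 4) by rewrite etaE; lra.
  have p2 : 0 < 1 - 26 * eta by rewrite etaE; lra.
  rewrite -(ler_pM2r (mulr_gt0 p1 p2)) mulrACA.
  apply: le_trans (_ : 1 <= _); last by rewrite etaE /th; lra.
  apply: mulr_ile1 h1 h2; apply: mulr_ge0; try exact: ltW.
    exact: exprn_ge0.
  by apply: exprn_ge0; rewrite addr_ge0.
have := @avoids_density_bound (1 + th) c eta k _ _ _ _ _ Kc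
  (26 * k) _ A A m 0 k.*2.
rewrite !addn0 add0n => /(_ _ _ _ _ _ erefl km _ AA).
have -> : 1 <= 1 + th by rewrite /th; lra.
have -> : (1 + (1 + th)) ^+ 2 <= 4 * (1 + th) * c.
  by rewrite /c etaE /th; lra.
have -> : 0 <= eta <= 1 / 110 by apply/andP; rewrite etaE; split; lra.
have -> : (m + 28 * k <= 200 * k)%N by lia.
have -> : (m + k.*2 + 26 * k <= m + 28 * k)%N by lia.
move=> /(_ isT isT isT (leqnn _) isT isT).
(* [12 * k.*2] letters pay for [k.*2] widenings from a single distance; the [k.*2] left over match
   the square of the density. *)
have -> : (26 * k = 12 * k.*2 + k.*2)%N by lia.
have lp : 0 < (1 + eta) ^+ (12 * k.*2) by rewrite exprn_gt0 // ltr_pwDl.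
rewrite exprD (mulrCA (density A * density A)) -[leRHS]mulr1 ler_pM2l //.
rewrite -muln2 exprM -expr2 -exprMn => h.
rewrite leNgt; apply/negP => gt1; move: h; apply/negP; rewrite -ltNge.
by rewrite exprn_egt1.
Qed.
End Density.

(** * Communication protocols *)

Section Monochromatic.
Local Open Scope nat_scope.
Variables (X Y Z : finType) (e1 : Z -> X) (e2 : Z -> Y).

(** Keeping at each bit the larger half of the indices costs a factor 2. The bit depends on one
    player's input only, so mixed pairs from the surviving set follow the same path to one leaf. *)
Lemma monochromatic_subset (p : protocol X Y) (S : {set Z}) (d : nat) :
  (forall z, z \in S -> bits_exchanged p (e1 z) (e2 z) <= d) ->
  exists b, exists T : {set Z},
    [/\ T \subset S, #|S| <= 2 ^ d * #|T| &
        {in T &, forall x y, output p (e1 x) (e2 y) = b}].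
Proof.
have halve (a : pred Z) (U : {set Z}) c (T1 T0 : {set Z}) :
    #|[set z in U | a z]| <= c * #|T1| ->
    #|[set z in U | ~~ a z]| <= c * #|T0| ->
    #|U| <= 2 * c * #|T1| \/ #|U| <= 2 * c * #|T0|.
  move=> h1 h0; have /= := cardsID [set z | a z] U.
  have -> : U :&: [set z | a z] = [set z in U | a z].
    by apply/setP=> z; rewrite !inE.
  have -> : U :\: [set z | a z] = [set z in U | ~~ a z].
    by apply/setP=> z; rewrite !inE andbC.
  move=> <-; case: (leqP #|T0| #|T1|) => [h|/ltnW h]; [left|right];
  by rewrite mul2n -addnn mulnDl leq_add // (leq_trans h1, leq_trans h0) //
             leq_mul2l h orbT.
have sub_filter (a : pred Z) (T U : {set Z}) :
    T \subset [set z in U | a z] -> T \subset U.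
  by move=> /subset_trans; apply; apply/subsetP => z; rewrite inE => /andP[].
elim: p S d => [b|a p1 IH1 p0 IH0|a p1 IH1 p0 IH0] S [|d] bnd.
- by exists b, S; rewrite expn0 mul1n.
- by exists b, S; split=> //; rewrite leq_pmull // expn_gt0.
(* A bit is sent here but the budget is 0, so [S] is empty. *)
- exists true, set0; split; rewrite ?sub0set //; last by move=> x; rewrite inE.
  rewrite cards0 muln0 leqn0 cards_eq0; apply/eqP/setP => z.
  by rewrite inE; apply/negP => /bnd.
- have [|b1 [T1 [s1 c1 m1]]] := IH1 [set z in S | a (e1 z)] d.
    by move=> z; rewrite inE => /andP[/bnd /= + az]; rewrite az.
  have [|b0 [T0 [s0 c0 m0]]] := IH0 [set z in S | ~~ a (e1 z)] d.
    by move=> z; rewrite inE => /andP[/bnd /= + /negbTE az]; rewrite az.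
  have [h|h] := halve (fun z => a (e1 z)) S _ _ _ c1 c0; rewrite -expnS in h.
    exists b1, T1; split=> //; first exact: sub_filter s1.
    move=> x y xT yT /=; have := subsetP s1 x xT.
    by rewrite inE => /andP[_ ->]; exact: m1.
  exists b0, T0; split=> //; first exact: sub_filter s0.
  move=> x y xT yT /=; have := subsetP s0 x xT.
  by rewrite inE => /andP[_ /negbTE ->]; exact: m0.
- exists true, set0; split; rewrite ?sub0set //; last by move=> x; rewrite inE.
  rewrite cards0 muln0 leqn0 cards_eq0; apply/eqP/setP => z.
  by rewrite inE; apply/negP => /bnd.
- have [|b1 [T1 [s1 c1 m1]]] := IH1 [set z in S | a (e2 z)] d.
    by move=> z; rewrite inE => /andP[/bnd /= + az]; rewrite az.
  have [|b0 [T0 [s0 c0 m0]]] := IH0 [set z in S | ~~ a (e2 z)] d.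
    by move=> z; rewrite inE => /andP[/bnd /= + /negbTE az]; rewrite az.
  have [h|h] := halve (fun z => a (e2 z)) S _ _ _ c1 c0; rewrite -expnS in h.
    exists b1, T1; split=> //; first exact: sub_filter s1.
    move=> x y xT yT /=; have := subsetP s1 y yT.
    by rewrite inE => /andP[_ ->]; exact: m1.
  exists b0, T0; split=> //; first exact: sub_filter s0.
  move=> x y xT yT /=; have := subsetP s0 y yT.
  by rewrite inE => /andP[_ /negbTE ->]; exact: m0.
Qed.
End Monochromatic.

(** * Encoding ternary words as bit strings *)

Section Encoding.
Local Open Scope nat_scope.

Lemma hamming_zip n (x y : n.-tuple bool) :
  hamming x y = count (fun p => p.1 != p.2) (zip x y).
Proof.
rewrite /hamming -sum1_card -sum1_count big_mkcond /=.
rewrite (big_nth (false, false)) size_zip !size_tuple minnn big_mkord.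
rewrite [RHS]big_mkcond /=; apply: eq_bigr => i _.
by rewrite inE nth_zip ?size_tuple // !(tnth_nth false).
Qed.

Definition encode_letter (i : 'I_3) : seq bool :=
  nth [::] [:: [:: false; false; false];
               [:: false; true; true];
               [:: true; false; true]] i.

Fixpoint encode_seq N : word N -> seq bool :=
  match N return word N -> seq bool with
  | 0 => fun _ => [::]
  | N'.+1 => fun x => encode_letter x.1 ++ encode_seq x.2
  end.

Lemma size_encode_letter i : size (encode_letter i) = 3.
Proof. by case: i => [[|[|[|]]]]. Qed.

Lemma size_encode_seq N (x : word N) : size (encode_seq x) = 3 * N.
Proof.
by elim: N x => //= N IH [i x]; rewrite size_cat size_encode_letter IH mulnS.
Qed.

Lemma count_encode N (x y : word N) :
  count (fun p => p.1 != p.2) (zip (encode_seq x) (encode_seq y)) =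
  2 * wdist x y.
Proof.
elim: N x y => //= N IH [i x] [j y] /=.
rewrite zip_cat ?size_encode_letter // count_cat IH mulnDr; congr (_ + _).
by case: i => [[|[|[|i]]] Hi] //; case: j => [[|[|[|j]]] Hj].
Qed.

Definition pad n N (b : bool) (x : word N) : seq bool :=
  encode_seq x ++ b :: nseq (n - (3 * N).+1) false.

Lemma size_pad n N b (x : word N) : 3 * N < n -> size (pad n b x) == n.
Proof.
by move=> hN; rewrite size_cat /= size_nseq size_encode_seq addnS -addSn subnKC.
Qed.

(* The bit [b] following the code word lets the two players differ in one
   position when n/2 is odd. *)
Definition encode_word n N (hN : 3 * N < n) (b : bool) (x : word N) :
    n.-tuple bool :=
  Tuple (size_pad b x hN).

Lemma hamming_encode n N (hN : 3 * N < n) b (x y : word N) :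
  hamming (encode_word hN false x) (encode_word hN b y) = b + 2 * wdist x y.
Proof.
rewrite hamming_zip /= zip_cat ?size_encode_seq // count_cat count_encode /=.
rewrite addnC.
congr (_ + _); rewrite -[RHS]addn0; congr (_ + _); first by case: b.
by elim: (n - _).
Qed.

End Encoding.

(* The communication lower bound *)
From mathcomp Require Import boolp classical_sets reals topology normedtype.
From mathcomp Require Import landau.
Import numFieldNormedType.Exports.

Section LowerBound.
Local Open Scope ring_scope.

Lemma base_gt1 (R : realFieldType) : 1 < 1 + (1 / 100) ^+ 2 :> R.
Proof. by rewrite ltrDl exprn_gt0 // divr_gt0. Qed.

(** Trades powers of 2 for powers of the density base without logarithms, by applying Bernoulli
    twice. *)
Lemma base_pow_ge2 (R : realFieldType) :
  2 <= (1 + (1 / 100) ^+ 2 : R) ^+ (100 * 100).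
Proof.
have th0 : 0 <= 1 / 100 :> R by lra.
rewrite exprM; apply: le_trans (_ : (1 + 1 / 100) ^+ 100 <= _).
  by apply: le_trans (bernoulli_ge 100 th0); lra.
apply: lerXn2r; rewrite ?nnegrE ?exprn_ge0 ?addr_ge0 ?sqr_ge0 //.
apply: le_trans (bernoulli_ge 100 (sqr_ge0 (1 / 100))).
by rewrite expr2; lra.
Qed.

Lemma det_cc_EQ'_lower n : ~~ odd n -> (0 < n %/ 4 %/ 85)%N ->
  (n %/ 4 %/ 85 <= 100 * 100 * det_cc (@EQ' n))%N.
Proof.
(* The divisor 85 makes the code fit: 3 (m + 28 k) = 3 m + 84 k < 4 m <= n. *)
move=> n_even; set m := (n %/ 4)%N; set k := (m %/ 85)%N => k_gt0.
have km : (85 * k <= m)%N by rewrite /k mulnC leq_trunc_div.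
have mk : (m <= 172 * k)%N by rewrite /k in k_gt0 *; lia.
have hN : (3 * (m + 28 * k) < n)%N by rewrite /m in km *; lia.
rewrite /det_cc; case: ex_minnP => d /asboolP[p [p_comp <-]] _ {d}.
pose b := odd n./2.
have half_n : (n./2 = b + 2 * m)%N by rewrite /b /m; lia.
have bnd z : z \in (finset.setTfor (word (m + 28 * k))) ->
    (bits_exchanged p (encode_word hN false z) (encode_word hN b z)
       <= cost p)%N.
  move=> _; exact: (leq_bigmax (encode_word hN false z, encode_word hN b z)).
have [b' [T [_ cardT monoT]]] := monochromatic_subset bnd.
have EQdiag z : EQ' (encode_word hN false z) (encode_word hN b z) = Some true.
  by rewrite /EQ' hamming_encode wdistxx muln0 addn0 !inE; case: (b).
(* Words at distance m would encode to inputs at distance n/2, where the output must differ from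
   that on the diagonal. *)
have avoidT : avoids T T m m.
  move=> x y xT yT; apply/negP; rewrite -eqn_leq => /eqP xy.
  have := p_comp _ _ _ (EQdiag x); rewrite (monoT _ _ xT xT) => b'E.
  have : EQ' (encode_word hN false x) (encode_word hN b y) = Some false.
    rewrite /EQ' hamming_encode -xy -half_n eqxx ifF // !inE.
    have m_gt0 : (85 <= m)%N by lia.
    by rewrite /m in m_gt0; clear -m_gt0 n_even; lia.
  by move=> /p_comp; rewrite (monoT _ _ xT yT) b'E.
have km26 : (26 * k <= m)%N by lia.
have := avoids_distance_density rat km26 mk avoidT.
move: (base_gt1 rat) (base_pow_ge2 rat).
move: (1 + (1 / 100) ^+ 2 : rat) => lam lam1 lam2 densT.
have dens1 : 1 <= 2 ^+ cost p * density rat T.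
  rewrite /density mulrA ler_pdivlMr ?exprn_gt0 // mul1r -!natrX -natrM ler_nat.
  by move: cardT; rewrite cardsT card_word.
rewrite -(ler_eXn2l lam1).
have lamk : lam ^+ k <= 2 ^+ cost p.
  have lk : 0 <= lam ^+ k by rewrite exprn_ge0 // ltW // (lt_trans ltr01).
  rewrite -[leLHS]mul1r (le_trans (ler_wpM2r lk dens1)) // -mulrA.
  by rewrite ler_piMr // exprn_ge0.
apply: le_trans lamk _; rewrite exprM lerXn2r ?nnegrE //.
by rewrite exprn_ge0 // ltW // (lt_trans ltr01).
Qed.

End LowerBound.

Local Open Scope classical_set_scope.
Local Open Scope ring_scope.

Theorem theorem2 (R : realType) :
  (fun n : nat => (det_cc (@EQ' n))%:R : R^o)
    \is 'Omega_(within [set n : nat | ~~ odd n] \oo) (fun n : nat => n%:R : R^o).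
Proof.
(* With k = [n %/ 4 %/ 85] >= 1, n < 340 (k + 1) <= 680 k; 700 is a round upper bound. *)
apply/asboolP; exists (700 * (100 * 100))%N%:R^-1.
  by rewrite invr_gt0 ltr0n.
rewrite near_withinE; near=> n => /= n_even.
have n_large : (400 <= n)%N by near: n; exact: nbhs_infty_ge.
rewrite !normr_nat mulrC ler_pdivrMr ?ltr0n // -natrM ler_nat.
have k_gt0 : (0 < n %/ 4 %/ 85)%N by clear -n_large; lia.
have low := det_cc_EQ'_lower n_even k_gt0.
rewrite mulnC -mulnA; apply: leq_trans (leq_mul (leqnn 700) low).
by clear -k_gt0; lia.
Unshelve. all: by end_near.
Qed.
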